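(* Let $s\in(0,1]$, let $I\subset(0,\infty)$ be a real interval, let $f:I\to\mathbb{R}$ be a harmonically $s$-convex function, and let $a,b\in I$ with $a<b$. If $f\in L[a,b]$, then $$2^{s-1}f\left(\frac{2ab}{a+b}\right)\le \frac{ab}{b-a}\int_a^b\frac{f(x)}{x^2}\,dx\le\frac{f(a)+f(b)}{s+1}.$$
   Context: For fixed $s\in(0,1]$ and a real interval $I\subset(0,\infty)$, a function $f:I\to\mathbb{R}$ is harmonically $s$-convex if $f\left(\frac{xy}{tx+(1-t)y}\right)\le t^s f(y)+(1-t)^s f(x)$ for all $x,y\in I$ and all $t\in[0,1]$. $L[a,b]$ denotes the Lebesgue integrable functions on $[a,b]$. *)

(* Defs.v *)
From HB Require Import structures.
From mathcomp Require Import all_boot all_order all_algebra.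
From mathcomp Require Import all_classical all_reals all_analysis.

Set Implicit Arguments.
Unset Strict Implicit.
Unset Printing Implicit Defensive.

Import Order.TTheory GRing.Theory Num.Theory.
Import numFieldNormedType.Exports.

Local Open Scope classical_set_scope.
Local Open Scope ring_scope.

(* A function I -> R is represented by a total f : R -> R of which only the
   values on I are used: for I an interval of positive reals, the harmonic
   combination of x and y lies in I.  For 0 < s, powR gives 0 `^ s = 0, so
   t = 0 and t = 1 carry their usual meaning. *)
Definition harmonically_s_convex (R : realType) (s : R) (I : set R)
    (f : R -> R) : Prop :=
  forall x y t : R, I x -> I y -> 0 <= t <= 1 ->
    f (x * y / (t * x + (1 - t) * y)) <= t `^ s * f y + (1 - t) `^ s * f x.

(* Main.v *)
(* With g u = f (1/u), harmonic s-convexity of f is s-convexity of g on the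
   interval [1/b, 1/a], which already forces g, hence f, to be continuous in the
   interior.  So x |-> \int_a^x f/y^2 dy is differentiable there, and both
   inequalities follow by monotonicity of one auxiliary function each, without
   changing variables in the integral of a merely integrable function.  For the
   left one, the auxiliary function involves the integral of f/y^2 from x to its
   harmonic reflection sg x, where 1/x + 1/(sg x) = 1/a + 1/b. *)
Require Import Defs.
From HB Require Import structures.
From mathcomp Require Import all_boot all_order all_algebra.
From mathcomp Require Import all_classical all_reals all_analysis.
From mathcomp Require Import measurable_realfun ring lra.

Import Order.TTheory GRing.Theory Num.Theory.
Import numFieldNormedType.Exports.

Local Open Scope classical_set_scope.
Local Open Scope ring_scope.

(** * Calculus tools: powers, monotonicity, antiderivatives *)

(* The absolute value matters: t `^ p is 1 for t < 0, hence discontinuous at 0. *)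
Lemma continuous_normr_powR (R : realType) (p : R) : 0 < p ->
  continuous (fun t : R => `|t| `^ p).
Proof.
move=> p0 x; have [->|x0] := eqVneq x 0.
  rewrite /continuous_at normr0 powR0 ?gt_eqF//.
  apply/cvgrPdist_lt => /= e e0; near=> t.
  rewrite sub0r normrN ger0_norm ?powR_ge0//.
  (* Writing [e] as a [p]-th power reduces the goal to [t] being closer to 0 than the [1/p]-th power
     of [e]. *)
  have -> : e = (e `^ p^-1) `^ p by rewrite -powRrM mulVf ?gt_eqF// powRr1// ltW.
  apply: gt0_ltr_powR; rewrite ?nnegrE ?powR_ge0//.
  rewrite -[t]subr0 distrC; near: t.
  by apply: cvgr_dist_lt; [exact: cvg_id | exact: powR_gt0].
have cp : {for `|x|, continuous (fun t : R => t `^ p)}.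
  apply/differentiable_continuous/derivable1_diffP/derivable_powR.
  by rewrite in_itv/= andbT normr_gt0.
exact: (continuous_comp (@norm_continuous _ R x) cp).
Unshelve. all: by end_near. Qed.

Lemma is_derive_normr_powR (R : realType) (p x : R) : 0 < x ->
  is_derive x 1 (fun t : R => `|t| `^ p) (p * x `^ (p - 1)).
Proof.
move=> x0; apply: near_eq_is_derive (is_derive1_powR p x0).
by near=> t; rewrite gtr0_norm//; near: t; exact: lt_nbhsr.
Unshelve. all: by end_near. Qed.

(** Both inequalities end with this criterion. It asks for the derivative only inside, because [f]
    may jump at the endpoints. *)
Lemma is_derive_le0_nincr (R : realType) (F dF : R -> R) (a b : R) : a <= b ->
  {in `[a, b], continuous F} ->
  {in `]a, b[, forall x : R, is_derive x 1 F (dF x)} ->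
  {in `]a, b[, forall x : R, dF x <= 0} ->
  F b <= F a.
Proof.
move=> ab cF dFE dF0; apply: (@ler0_derive1_nincr _ F a b) => //.
- by move=> x /dFE[].
- by move=> x xab; rewrite derive1E; have [_ ->] := dFE x xab; exact: dF0.
- by apply: continuous_in_subspaceT => x; rewrite inE/= => /cF.
Qed.

(** Extending [h] by zero to [[a - 1, b + 1]] turns [a] and [b] into interior points, so the
    integral from [a - 1] is continuous on both sides there. Inside []a, b[] the extension agrees
    locally with [h], and the fundamental theorem applies. *)
Lemma continuous_antiderivative (R : realType) (h : R -> R) (a b : R) : a <= b ->
  (@lebesgue_measure R).-integrable `[a, b] (EFin \o h) ->
  exists F : R -> R, [/\ {in `[a, b], continuous F},
    {in `]a, b[, forall x : R, {for x, continuous h} -> is_derive x 1 F (h x)} &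
    F b - F a = \int[@lebesgue_measure R]_(x in `[a, b]) h x].
Proof.
move=> ab hi; pose hab := h \_ `[a, b].
have habi : (@lebesgue_measure R).-integrable `[a - 1, b + 1] (EFin \o hab).
  rewrite -restrict_EFin; apply/integrable_restrict => //=.
  rewrite setIidr//; by move=> x /=; rewrite !in_itv/=; lra.
pose F x := \int[@lebesgue_measure R]_(t in `[a - 1, x]) hab t.
have cF : {within `[a - 1, b + 1], continuous F}.
  by apply: parameterized_integral_continuous habi; lra.
exists F; split.
- move=> x; rewrite in_itv/= => xab.
  by apply: (within_continuous_continuous _ cF); rewrite ?in_itv/=; lra.
- move=> x xab ch.
  have chab : {for x, continuous hab}.
    rewrite /prop_for /continuous_at /hab patchE mem_set; last exact: subset_itv_oo_cc.
    apply: cvg_trans ch; apply: near_eq_cvg; near=> z.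
    rewrite /hab patchE mem_set//; apply: subset_itv_oo_cc; near: z.
    exact: near_in_itvoo.
  have [||dF FE] := @continuous_FTC1_closed _ hab (a - 1) x (b + 1) _ habi _ chab.
  + by move: xab; rewrite in_itv/=; lra.
  + by move: xab; rewrite in_itv/=; lra.
  split => //; rewrite -derive1E FE /hab patchE mem_set//.
  exact: subset_itv_oo_cc.
- rewrite /F -!Rintegral_mkcondr.
  (* Hence [F a] is an integral over a single point and vanishes. *)
  have -> : `[a - 1, a] `&` `[a, b] = [set a].
    apply/seteqP; split => x /=; rewrite !in_itv/=.
      by move=> [/andP[_ xa] /andP[ax _]]; apply/eqP; rewrite eq_le xa ax.
    by move=> ->; lra.
  rewrite Rintegral_set1 subr0 setIidr//; by move=> x /=; rewrite !in_itv/=; lra.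
Unshelve. all: by end_near. Qed.

(** * Continuity of s-convex and harmonically s-convex functions *)

(* s-convexity on [p, q] with the point z between u and q bounds g z from above,
   and with u between p and z bounds it from below. *)
Lemma s_convex_cvg_at_right (R : realType) (s : R) (g : R -> R) (p q u : R) :
  0 < s ->
  (forall x y t, x \in `[p, q] -> y \in `[p, q] -> 0 <= t <= 1 ->
    g (t * x + (1 - t) * y) <= t `^ s * g x + (1 - t) `^ s * g y) ->
  p < u < q -> g z @[z --> u^'+] --> g u.
Proof.
move=> s0 gs /andP[pu uq].
(* These weights give [z = t z * q + (1 - t z) * u] and [u = r z * p + (1 - r z) * z]; both vanish
   at [z = u]. *)
pose t z := (z - u) / (q - u); pose r z := (z - u) / (z - p).
have cp := continuous_normr_powR _ _ s0.
have ct : {for u, continuous t}.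
  exact: (cvgM (cvgB cvg_id (cvg_cst _)) (cvg_cst _)).
have cr : {for u, continuous r}.
  apply: cvgM; first by apply: cvgB; [exact: cvg_id|exact: cvg_cst].
  apply: cvgV; first by rewrite subr_eq0 gt_eqF.
  by apply: cvgB; [exact: cvg_id|exact: cvg_cst].
have t0 : t u = 0 by rewrite /t subrr mul0r.
have r0 : r u = 0 by rewrite /r subrr mul0r.
have cs (k : R -> R) (l : R) : {for u, continuous k} -> k u = l ->
    `|k z| `^ s @[z --> u] --> `|l| `^ s.
  by move=> ck <-; exact: (continuous_comp ck (cp _)).
have c0 (k : R -> R) : {for u, continuous k} -> k u = 0 ->
    `|k z| `^ s @[z --> u] --> (0 : R).
  by move=> ck /(cs _ _ ck); rewrite normr0 powR0 ?gt_eqF.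
have c1 (k : R -> R) : {for u, continuous k} -> k u = 0 ->
    `|1 - k z| `^ s @[z --> u] --> (1 : R).
  move=> ck k0; have := cs (fun z => 1 - k z) 1; rewrite normr1 powR1; apply.
    by apply: cvgB => //; exact: cvg_cst.
  by rewrite k0 subr0.
(* The lower bound is the convexity inequality at [u] solved for [g z]. The absolute values make
   both bounds continuous at [u] from either side, and they do nothing for [z > u]. *)
apply: (@squeeze_cvgr _ _ _ _
  (fun z => (g u - `|r z| `^ s * g p) / `|1 - r z| `^ s)
  (fun z => `|t z| `^ s * g q + `|1 - t z| `^ s * g u)).
- near=> z.
  have uz : u < z by near: z; exact: nbhs_right_gt.
  have zq : z < q by near: z; exact: nbhs_right_lt.
  have qu0 : 0 < q - u by lra.
  have zp0 : 0 < z - p by lra.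
  have t01 : 0 <= t z <= 1.
    by rewrite /t divr_ge0/= ?ler_pdivrMr; lra.
  have r01 : 0 <= r z < 1.
    by rewrite /r divr_ge0/= ?ltr_pdivrMr; lra.
  rewrite !ger0_norm; try lra.
  apply/andP; split.
    rewrite ler_pdivrMr; last by apply: powR_gt0; lra.
    rewrite lerBlDl [g z * _]mulrC.
    have uE : r z * p + (1 - r z) * z = u by rewrite /r; field; lra.
    by rewrite -[X in g X <= _]uE; apply: gs; rewrite ?in_itv/=; lra.
  have zE : t z * q + (1 - t z) * u = z by rewrite /t; field; lra.
  by rewrite -[X in g X <= _]zE; apply: gs; rewrite ?in_itv/=; lra.
- apply: cvg_at_right_filter.
  have -> : g u = (g u - 0 * g p) / 1 by rewrite mul0r subr0 divr1.
  apply: (cvgM _ (cvgV (oner_neq0 R) (c1 _ cr r0))).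
  rewrite mul0r subr0 divr1 -[X in _ --> X]subr0 -(mul0r (g p)).
  exact: (cvgB (cvg_cst _) (cvgM (c0 _ cr r0) (cvg_cst _))).
- apply: cvg_at_right_filter.
  rewrite -[X in _ --> X]add0r -(mul0r (g q)) -[X in _ --> _ + X]mul1r.
  exact: (cvgD (cvgM (c0 _ ct t0) (cvg_cst _)) (cvgM (c1 _ ct t0) (cvg_cst _))).
Unshelve. all: by end_near. Qed.

(** The left limit at [u] is a right limit at [- u] of the reflected function, which is s-convex on
    [[- q, - p]]. *)
Lemma s_convex_continuous (R : realType) (s : R) (g : R -> R) (p q : R) :
  0 < s ->
  (forall x y t, x \in `[p, q] -> y \in `[p, q] -> 0 <= t <= 1 ->
    g (t * x + (1 - t) * y) <= t `^ s * g x + (1 - t) `^ s * g y) ->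
  {in `]p, q[, continuous g}.
Proof.
move=> s0 gs u; rewrite in_itv/= => puq; apply/left_right_continuousP; split.
  apply/cvg_at_leftNP; rewrite -[u in g u]opprK.
  apply: (@s_convex_cvg_at_right _ s (g \o -%R) (- q) (- p)) => //=; last by lra.
  move=> x y t xpq ypq t01; rewrite opprD -!mulrN.
  by apply: gs => //; move: xpq ypq; rewrite !in_itv/=; lra.
exact: (@s_convex_cvg_at_right _ s _ p q).
Qed.

Lemma is_derive1_inv (R : realType) (x : R) : x != 0 ->
  is_derive x 1 (fun y : R => y^-1) (- x ^- 2).
Proof.
move=> x0; have := @is_deriveV R id x 1 1 x0 (is_derive_id x 1).
by rewrite /GRing.scale/= mulr1.
Qed.

Lemma harmonically_s_convex_continuous (R : realType) (s : R) (f : R -> R)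
    (a b : R) :
  0 < s -> 0 < a -> harmonically_s_convex s `[a, b] f ->
  {in `]a, b[, continuous f}.
Proof.
move=> s0 a0 hf x; rewrite in_itv/= => axb.
have -> : f = (fun u => f u^-1) \o GRing.inv.
  by apply/funext => y /=; rewrite invrK.
have x0 : x != 0 by apply/lt0r_neq0; lra.
apply: (continuous_comp (inv_continuous x0)).
apply: (@s_convex_continuous _ s (fun u => f u^-1) b^-1 a^-1) => //; last first.
  by rewrite in_itv/= !ltf_pV2 ?posrE; lra.
move=> u v t; rewrite !in_itv/= => bua bva t01.
have b0 : 0 < b^-1 by rewrite invr_gt0; lra.
have u0 : 0 < u by lra.
have v0 : 0 < v by lra.
have inv_itv w : 0 < w -> b^-1 <= w <= a^-1 -> `[a, b]%classic w^-1.
  move=> w0 /andP[bw wa]; rewrite /= in_itv/=; apply/andP; split.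
    by rewrite -[a]invrK lef_pV2 ?posrE ?invr_gt0.
  by rewrite invf_ple ?posrE//; lra.
have tuv : 0 < t * u + (1 - t) * v by nra.
(* The arguments are swapped because the definition pairs the weight of [t] with the value at its
   second point. *)
have := hf _ _ t (inv_itv v v0 bva) (inv_itv u u0 bua) t01.
congr (f _ <= _); field.
by rewrite !gt_eqF//; lra.
Qed.

(** * The left inequality *)

(** [Psi] is nonincreasing from [a] to the harmonic mean [H], the fixed point of [sg]. Since
    [sg a = b], [Psi a] contains the whole integral, while the integral term of [Psi H] is zero. *)
Lemma harmonic_hadamard_left (R : realType) (s : R) (f : R -> R) (a b : R) :
  0 < s -> 0 < a -> a < b -> harmonically_s_convex s `[a, b] f ->
  (@lebesgue_measure R).-integrable `[a, b] (EFin \o (fun x => f x / x ^+ 2)) ->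
  2 `^ s * f (2 * a * b / (a + b)) * ((a^-1 - b^-1) / 2) <=
    \int[@lebesgue_measure R]_(x in `[a, b]) (f x / x ^+ 2).
Proof.
move=> s0 a0 ab hf hi.
have b0 : 0 < b by lra.
have cf := harmonically_s_convex_continuous _ _ _ _ _ s0 a0 hf.
have [F [cF dF <-]] := continuous_antiderivative _ _ _ _ (ltW ab) hi.
pose c := a^-1 + b^-1; pose sg x := (c - x^-1)^-1.
pose H := 2 * a * b / (a + b).
have aH : a < H by rewrite /H ltr_pdivlMr; nra.
have Hb : H < b by rewrite /H ltr_pdivrMr; nra.
have bV0 : 0 < b^-1 by rewrite invr_gt0.
have HV : H^-1 = c / 2 by rewrite /H /c; field; rewrite !gt_eqF; lra.
have sgE x : a <= x <= H -> [/\ 0 < c - x^-1, H <= sg x & sg x <= b].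
  move=> /andP[ax xH]; have x0 : 0 < x by lra.
  have xa : x^-1 <= a^-1 by rewrite lef_pV2.
  have Hx : H^-1 <= x^-1 by rewrite lef_pV2 ?posrE//; lra.
  have cx0 : 0 < c - x^-1 by rewrite /c; lra.
  split => //; rewrite /sg.
    by rewrite -[H]invrK lef_pV2 ?posrE ?invr_gt0//; lra.
  by rewrite invf_ple ?posrE// /c; lra.
have dh x : x \in `]a, b[ -> is_derive x 1 F (f x / x ^+ 2).
  move=> xab; apply: dF => //; apply: (cvgM (cf _ xab)).
  apply: cvgV; first by rewrite expf_neq0// gt_eqF//; move: xab; rewrite in_itv/=; lra.
  exact: (@exprn_continuous R 2).
pose Psi x := F (sg x) - F x - 2 `^ s * f H * x^-1.
suff : Psi H <= Psi a.
  have sgH : sg H = H by rewrite /sg /c /H; field; rewrite !gt_eqF; lra.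
  have sga : sg a = b by rewrite /sg /c addrAC subrr add0r invrK.
  rewrite /Psi sgH sga subrr.
  rewrite HV /c -/H; lra.
(* The factor [(sg x) ^+ 2] will cancel the denominator in the derivative of [F] at [sg x]. *)
have dsg x : a <= x <= H -> is_derive x 1 sg (- (sg x) ^+ 2 / x ^+ 2).
  move=> axH; have [cx0 _ _] := sgE x axH.
  have x0 : x != 0 by rewrite gt_eqF//; lra.
  have cx1 : c - x^-1 != 0 by rewrite gt_eqF.
  have dc := is_deriveB (is_derive_cst c x 1) (is_derive1_inv _ _ x0).
  apply: (is_derive_eq (@is_deriveV _ (fun y => c - y^-1) x _ 1 cx1 dc)).
  by rewrite /GRing.scale/= /sg exprVn sub0r opprK mulNr.
apply: (@is_derive_le0_nincr _ Psi
  (fun x => (2 `^ s * f H - f x - f (sg x)) / x ^+ 2)) => //; first exact: ltW.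
- move=> x; rewrite in_itv/= => axH.
  have [cx0 Hsg sgb] := sgE x axH.
  have x0 : x != 0 by rewrite gt_eqF//; lra.
  have csg : {for x, continuous sg}.
    by have [d _] := dsg x axH; exact/differentiable_continuous/derivable1_diffP.
  apply: cvgB; last exact: (cvgM (cvg_cst _) (inv_continuous x0)).
  apply: cvgB; last by apply: cF; rewrite in_itv/=; lra.
  by apply: (continuous_comp csg); apply: cF; rewrite in_itv/=; lra.
- move=> x; rewrite in_itv/= => axH.
  have axH' : a <= x <= H by lra.
  have [cx0 Hsg sgb] := sgE x axH'.
  have x0 : x != 0 by rewrite gt_eqF//; lra.
  have sgx0 : sg x != 0 by rewrite gt_eqF//; lra.
  (* Strictness is needed: [F] is known to be differentiable only inside []a, b[]. *)
  have sgxb : sg x < b.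
    rewrite /sg -[ltRHS]invrK ltf_pV2 ?posrE//.
    have : x^-1 < a^-1 by rewrite ltf_pV2 ?posrE; lra.
    rewrite /c; lra.
  have dFs : is_derive (sg x) 1 F (f (sg x) / (sg x) ^+ 2).
    by apply: dh; rewrite in_itv/=; lra.
  have dFx : is_derive x 1 F (f x / x ^+ 2) by apply: dh; rewrite in_itv/=; lra.
  have dV := is_deriveZ (2 `^ s * f H) (is_derive1_inv _ _ x0).
  have dcomp := is_derive1_comp dFs (dsg x axH').
  apply: (is_derive_eq (is_deriveB (is_deriveB dcomp dFx) dV)).
  by rewrite /GRing.scale/=; field; rewrite sgx0 x0.
- move=> x; rewrite in_itv/= => axH.
  have axH' : a <= x <= H by lra.
  have [cx0 Hsg sgb] := sgE x axH'.
  have x0 : 0 < x by lra.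
  have sgx0 : 0 < sg x by lra.
  rewrite pmulr_lle0 ?invr_gt0 ?exprn_gt0//.
  have xI : `[a, b]%classic x by rewrite /= in_itv/=; lra.
  have sgI : `[a, b]%classic (sg x) by rewrite /= in_itv/=; lra.
  (* With equal weights, [x] and [sg x] always combine to [H], so the numerator of the derivative is
     at most 0. *)
  have half : 0 <= (2^-1 : R) <= 1 by lra.
  have := hf _ _ _ xI sgI half.
  have -> : 1 - 2^-1 = 2^-1 :> R by lra.
  have -> : x * sg x / (2^-1 * x + 2^-1 * sg x) = H.
    have xsg : x^-1 + (sg x)^-1 = c by rewrite /sg invrK subrKC.
    rewrite -[RHS]invrK HV -xsg; field.
    by rewrite !gt_eqF//; lra.
  have -> : 2^-1 `^ s = (2 `^ s)^-1 :> R.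
    by rewrite -powR_inv1// -powRrM mulN1r powRN.
  have p0 : 0 < 2 `^ s :> R by exact: powR_gt0.
  rewrite -mulrDr mulrC ler_pdivlMr//; lra.
Qed.

(** * The right inequality *)

(** Convexity between [a] and [b] bounds [f x] by powers of [t x] and [1 - t x]. As [t] has
    derivative [x ^- 2 / D], this bound divided by [x ^+ 2] has the explicit antiderivative
    [D / (s + 1) * G x], and [Psi] compares [F] with it. *)
Lemma harmonic_hadamard_right (R : realType) (s : R) (f : R -> R) (a b : R) :
  0 < s -> 0 < a -> a < b -> harmonically_s_convex s `[a, b] f ->
  (@lebesgue_measure R).-integrable `[a, b] (EFin \o (fun x => f x / x ^+ 2)) ->
  \int[@lebesgue_measure R]_(x in `[a, b]) (f x / x ^+ 2) <=
    (a^-1 - b^-1) * ((f a + f b) / (s + 1)).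
Proof.
move=> s0 a0 ab hf hi.
have b0 : 0 < b by lra.
have cf := harmonically_s_convex_continuous _ _ _ _ _ s0 a0 hf.
have [F [cF dF <-]] := continuous_antiderivative _ _ _ _ (ltW ab) hi.
(* [t x] is the position of [1/x] between [1/a] and [1/b]: [1/x = (1 - t x) / a + t x / b]. *)
pose D := a^-1 - b^-1; pose t x := (a^-1 - x^-1) / D.
have D0 : 0 < D by rewrite /D subr_gt0 ltf_pV2.
have s1 : s + 1 != 0 by rewrite gt_eqF//; lra.
(* The absolute values keep [G] continuous at [a] and [b], where one of the two bases is 0; the
   minus sign comes from [1 - t] decreasing. *)
pose G x := f b * `|t x| `^ (s + 1) - f a * `|1 - t x| `^ (s + 1).
pose Psi x := F x - D / (s + 1) * G x.
suff : Psi b <= Psi a.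
  have ta : t a = 0 by rewrite /t subrr mul0r.
  have tb : t b = 1 by rewrite /t divff// gt_eqF.
  rewrite /Psi /G ta tb subrr subr0 normr0 normr1 powR1 powR0//.
  have : D / (s + 1) * f a + D / (s + 1) * f b = D * ((f a + f b) / (s + 1)).
    by field.
  by rewrite -/D; lra.
have dt (x : R) : 0 < x -> is_derive x 1 t (x ^- 2 / D).
  move=> x0; have x1 : x != 0 by rewrite gt_eqF.
  have dV := is_deriveB (is_derive_cst a^-1 x 1) (is_derive1_inv _ _ x1).
  apply: (is_derive_eq (is_deriveM dV (is_derive_cst D^-1 x 1))).
  by rewrite /GRing.scale/= mulr0 add0r sub0r opprK mulrC.
have t01 (x : R) : a < x < b -> 0 < t x < 1.
  move=> /andP[ax xb]; have x0 : 0 < x by lra.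
  have xa : x^-1 < a^-1 by rewrite ltf_pV2.
  have bx : b^-1 < x^-1 by rewrite ltf_pV2.
  apply/andP; split; first by rewrite divr_gt0// subr_gt0.
  rewrite /t ltr_pdivrMr// mul1r /D; lra.
apply: (@is_derive_le0_nincr _ Psi
  (fun x => (f x - t x `^ s * f b - (1 - t x) `^ s * f a) / x ^+ 2)) => //.
- exact: ltW.
- move=> x xab; have x0 : 0 < x by move: xab; rewrite in_itv/=; lra.
  have ct : {for x, continuous t}.
    by have [d _] := dt x x0; exact/differentiable_continuous/derivable1_diffP.
  have c1t : {for x, continuous (fun y => 1 - t y)}.
    by apply: cvgB => //; exact: cvg_cst.
  have p0 : 0 < s + 1 by lra.
  have cp := continuous_normr_powR _ _ p0.
  apply: cvgB; first exact: cF.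
  apply: (cvgM (cvg_cst _)); apply: cvgB; apply: (cvgM (cvg_cst _)).
    exact: (continuous_comp ct (cp _)).
  exact: (continuous_comp c1t (cp _)).
- move=> x xab; have axb : a < x < b by move: xab; rewrite in_itv.
  have x0 : 0 < x by lra.
  have x1 : x != 0 by rewrite gt_eqF.
  have /andP[tx0 tx1] := t01 x axb.
  have tx1' : 0 < 1 - t x by lra.
  have dFx : is_derive x 1 F (f x / x ^+ 2).
    apply: dF => //; apply: (cvgM (cf _ xab)).
    by apply: cvgV; [rewrite expf_neq0|exact: (@exprn_continuous R 2)].
  have dp := is_derive1_comp (is_derive_normr_powR _ (s + 1) _ tx0) (dt x x0).
  have dq := @is_derive1_comp R (fun y => `|y| `^ (s + 1)) (fun y => 1 - t y) x _ _
    (is_derive_normr_powR _ (s + 1) _ tx1') (is_deriveB (is_derive_cst (1 : R) x 1) (dt x x0)).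
  have dG := is_deriveB (is_deriveZ (f b) dp) (is_deriveZ (f a) dq).
  apply: (is_derive_eq (is_deriveB dFx (is_deriveZ (D / (s + 1)) dG))).
  rewrite /GRing.scale/= !addrK; field.
  by rewrite s1 x1 gt_eqF.
- move=> x; rewrite in_itv/= => axb.
  have x0 : 0 < x by lra.
  have tx := t01 x axb.
  rewrite pmulr_lle0 ?invr_gt0 ?exprn_gt0//.
  have aI : `[a, b]%classic a by rewrite /= in_itv/=; lra.
  have bI : `[a, b]%classic b by rewrite /= in_itv/=; lra.
  have t01' : 0 <= t x <= 1 by lra.
  have := hf _ _ _ aI bI t01'.
  have -> : a * b / (t x * a + (1 - t x) * b) = x.
    have -> : t x * a + (1 - t x) * b = a * b / x.
      rewrite /t /D; field.
      by rewrite mulN1r subr_eq0 !gt_eqF.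
    by field; rewrite !gt_eqF.
  lra.
Qed.

(** * Integrability of the weighted function and conclusion *)

(** On [[a, b]] the weight [x ^- 2] is continuous and bounded by [a ^- 2], so it preserves
    integrability. *)
Lemma integrable_div_sqr (R : realType) (f : R -> R) (a b : R) :
  0 < a -> (@lebesgue_measure R).-integrable `[a, b] (EFin \o f) ->
  (@lebesgue_measure R).-integrable `[a, b] (EFin \o (fun x => f x / x ^+ 2)).
Proof.
move=> a0 fi; have cV : {within `[a, b], continuous (fun x : R => x ^- 2)}.
  apply: continuous_in_subspaceT => x; rewrite inE/= in_itv/= => /andP[ax _].
  apply: cvgV; last exact: (@exprn_continuous R 2).
  by rewrite expf_neq0// gt_eqF// (lt_le_trans a0).
have -> : EFin \o (fun x => f x / x ^+ 2) =
    ((EFin \o f) \* (EFin \o (fun x : R => x ^- 2)))%E by [].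
apply: integrableMl => //; first exact: subspace_continuous_measurable_fun.
exists (a ^- 2); split; first by rewrite num_real.
move=> M aM x /=; rewrite in_itv/= => /andP[ax _].
have x0 : 0 < x by exact: lt_le_trans ax.
rewrite ger0_norm ?invr_ge0 ?exprn_ge0 ?ltW//.
apply: le_lt_trans aM; rewrite lef_pV2 ?posrE ?exprn_gt0//.
by rewrite ler_pXn2r// nnegrE ltW.
Qed.

Theorem theorem3 (R : realType) (s : R) (I : set R) (f : R -> R) (a b : R)
  (hs : 0 < s <= 1)
  (hI : is_interval I)
  (hIpos : I `<=` `]0, +oo[)
  (hf : harmonically_s_convex s I f)
  (ha : I a) (hb : I b) (hab : a < b)
  (hint : (@lebesgue_measure R).-integrable `[a, b] (EFin \o f)) :
  2 `^ (s - 1) * f (2 * a * b / (a + b))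
    <= a * b / (b - a) * (\int[@lebesgue_measure R]_(x in `[a, b]) (f x / x ^+ 2))
  /\
  a * b / (b - a) * (\int[@lebesgue_measure R]_(x in `[a, b]) (f x / x ^+ 2))
    <= (f a + f b) / (s + 1).
Proof.
have /andP[s0 _] := hs.
have a0 : 0 < a by have := hIpos _ ha; rewrite /= in_itv/= andbT.
have abI : `[a, b] `<=` I.
  by move=> x; rewrite /= in_itv/= => axb; exact: (hI a b).
have hfab : harmonically_s_convex s `[a, b] f.
  by move=> x y t xab yab; apply: hf; exact: abI.
have hi := integrable_div_sqr _ _ _ _ a0 hint.
have left := harmonic_hadamard_left _ _ _ _ _ s0 a0 hab hfab hi.
have right := harmonic_hadamard_right _ _ _ _ _ s0 a0 hab hfab hi.
have b0 : 0 < b by lra.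
have D0 : 0 < a^-1 - b^-1 by rewrite subr_gt0 ltf_pV2.
(* The prefactor is the inverse of the length of [[1/b, 1/a]], by which both bounds are now
   divided. *)
have -> : a * b / (b - a) = (a^-1 - b^-1)^-1.
  by rewrite -[LHS]invrK; congr _^-1; field; rewrite subr_eq0 !gt_eqF.
split; last by rewrite mulrC ler_pdivrMr// mulrC.
rewrite mulrC -[leRHS]mulrC ler_pdivlMr//.
rewrite powRB ?pnatr_eq0 ?implybT// powRr1//; lra.
Qed.
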